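(* Fix a field $\mathbb{F}$ and a finite subset $S\subseteq \mathbb{F}$ with $|S|\geq 2$. Let $B_1,\dots,B_n\subseteq S^n$ be independent random bases of $\mathbb{F}^n$, where each $B_i$ is chosen uniformly at random from the collection $\{B\subseteq S^n\mid B\text{ is a basis of }\mathbb{F}^n\}$. Then, with probability $1-o(1)$ as $n\to\infty$, the multi-set $B_1\cup\dots\cup B_n$ can be partitioned into $n$ bases of $\mathbb{F}^n$ which are transversal with respect to $B_1,\dots,B_n$.
   Context: A basis $B\subseteq B_1\cup\dots\cup B_n$ (a sub-multiset of the multi-set union) is called transversal with respect to $B_1,\dots,B_n$ if it contains exactly one vector from each of $B_1,\dots,B_n$; here $B_1,\dots,B_n$ are regarded as subsets of the multi-set $B_1\cup\dots\cup B_n$, and copies of a vector occurring in several bases are distinguished by which $B_i$ they come from. *)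

(* Defs.v *)
From HB Require Import structures.
From mathcomp Require Import all_boot all_order all_algebra finmap.
From mathcomp Require Import reals.

Set Implicit Arguments.
Unset Strict Implicit.
Unset Printing Implicit Defensive.

Import Order.TTheory GRing.Theory Num.Theory.

Local Open Scope ring_scope.

Section FiniteProbability.
Variable R : realType.

Definition uniform_pmf (T : finType) (A : {set T}) (x : T) : R :=
  if x \in A then #|A|%:R^-1 else 0.

(* Probability of the event [E] when the [n] coordinates are independent and
   the i-th one has probability mass function [p i]. *)
Definition indep_prob (n : nat) (T : finType) (p : 'I_n -> T -> R)
    (E : pred {ffun 'I_n -> T}) : R :=
  \sum_(f | E f) \prod_(i < n) p i (f i).

End FiniteProbability.

Section TransversalBases.
Variables (F : fieldType) (S : {fset F}) (n : nat).

(* 'rV[S]_n is the finite type of vectors in S^n; vecF is the inclusion of S^n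
   into F^n. *)
Definition vecF (v : 'rV[S]_n) : 'rV[F]_n := map_mx val v.

Definition bases : {set {set 'rV[S]_n}} :=
  [set B : {set 'rV[S]_n} | basis_of fullv [seq vecF v | v <- enum B]].

(* The multi-set union of B_0, ..., B_(n-1): the pair (i, v) is the copy of v
   that comes from B_i. *)
Definition munion (B : 'I_n -> {set 'rV[S]_n}) : {set 'I_n * 'rV[S]_n} :=
  [set x | x.2 \in B x.1].

(* The list below keeps repetitions, so a sub-multiset in which a vector occurs
   twice is not a basis. *)
Definition mbasis (D : {set 'I_n * 'rV[S]_n}) : bool :=
  basis_of fullv [seq vecF x.2 | x <- enum D].

Definition transversal_wrt (B : 'I_n -> {set 'rV[S]_n})
    (D : {set 'I_n * 'rV[S]_n}) : bool :=
  (D \subset munion B) && [forall i, #|[set x in D | x.1 == i]| == 1%N].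

Definition transversal_partition (B : 'I_n -> {set 'rV[S]_n}) : bool :=
  [exists P : {set {set 'I_n * 'rV[S]_n}},
    [&& partition P (munion B), #|P| == n
      & [forall D in P, mbasis D && transversal_wrt B D]]].

End TransversalBases.

(* Main.v *)
(** Order each basis at random.  Row [i] is then a uniformly random ordered basis
    of F^n with entries in S, and a vector of S^n lies in a fixed subspace U with
    probability at most 2^-(codim U); in particular a constant proportion of the
    n-tuples of vectors are bases, so conditioning on the n rows being bases costs
    at most a factor 4^n.  The transversals are built row by row.  Let L be about
    log2 n.  In the first n - 3L rows the j-th vectors can be put together in the
    j-th transversal: a collision has probability O(1/n).  In each later row the
    vectors must be matched with the spans T_1, ..., T_n of the current partial
    transversals, avoiding incidences.  By Hall's theorem a failure yields a set A
    of vectors of the row and a set J of indices with #A + #J = n + 1 such that A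
    lies in the intersection of the T_j, j in J.  This is unlikely as soon as the
    intersection of T_j, j in J, has codimension at least 5L whenever J has
    polylogarithmic size.  Otherwise 5L of these T_j would have an intersection W
    of codimension < 5L contained in all the others; but the first n - 3L entries
    of a column independent of W fail to span F^n modulo W with exponentially small
    probability, so having polylogarithmically many such columns beats both the
    union bound over the last 3L entries of the columns defining W and the
    factor 4^n. *)

Require Import Defs.
From HB Require Import structures.
From mathcomp Require Import all_boot all_order all_algebra finmap.
From mathcomp Require Import perm reals zify ring lra.

Set Implicit Arguments.
Unset Strict Implicit.
Unset Printing Implicit Defensive.

Import Order.TTheory GRing.Theory Num.Theory.

Local Open Scope ring_scope.

(** * Hall's theorem and averaging over one coordinate *)

Section Hall.
Variables (T : finType) (r : rel T).
Implicit Types X Y A B : {set T}.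

Definition nbhd A : {set T} := [set u | [exists t in A, r t u]].

Lemma nbhdP A u : reflect (exists2 t, t \in A & r t u) (u \in nbhd A).
Proof. by rewrite inE; apply: exists_inP. Qed.

Lemma nbhdU A B : nbhd (A :|: B) = nbhd A :|: nbhd B.
Proof.
apply/setP => u; rewrite in_setU; apply/nbhdP/orP.
  by move=> [t]; rewrite in_setU => /orP[] tA rtu; [left | right]; apply/nbhdP; exists t.
by move=> [] /nbhdP[t tA rtu]; exists t => //; rewrite in_setU tA ?orbT.
Qed.

(** Induction on [#|X|]. If some nonempty proper subset is tight, it and its complement are matched
    separately; otherwise an arbitrary [x] is matched with any neighbour [y], and the strict
    inequalities absorb the loss of [y]. The set [Y] records which targets are still free. *)
Lemma hall_rec X Y :
  (forall A, A \subset X -> (#|A| <= #|nbhd A :&: Y|)%N) ->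
  exists2 f : T -> T, {in X &, injective f}
    & forall x, x \in X -> (f x \in Y) && r x (f x).
Proof.
have [k] := ubnP #|X|; elim: k X Y => // k IH X Y ltXk hallX.
have [->|/set0Pn[x xX]] := eqVneq X set0.
  by exists id => x; rewrite inE.
have [[A [An0 AX tightA]]|tightN] :
  (exists A, [/\ A != set0, A \proper X & #|nbhd A :&: Y| = #|A|]) \/
  (forall A, A != set0 -> A \proper X -> (#|A| < #|nbhd A :&: Y|)%N).
- have [/existsP[A /and3P[? ? /eqP ?]]|/existsPn noA] := boolP
    [exists A : {set T}, [&& A != set0, A \proper X & #|nbhd A :&: Y| == #|A|]].
    by left; exists A.
  right=> A An0 AX; have := noA A; rewrite An0 AX /= ltn_neqAle eq_sym => ->.
  by apply: hallX; apply: proper_sub.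
- have [||f injf fP] := IH A Y.
  + exact: leq_trans (proper_card AX) ltXk.
  + by move=> B BA; apply: hallX; apply: subset_trans BA (proper_sub AX).
  have [||g injg gP] := IH (X :\: A) (Y :\: nbhd A).
  + rewrite -ltnS; apply: leq_trans ltXk;
    rewrite ltnS -(cardsID A X) (setIidPr (proper_sub AX)).
    by rewrite -add1n leq_add2r card_gt0.
  + move=> B BXA; have BAd : [disjoint A & B].
      by rewrite disjoint_sym; apply: disjointWl BXA _;
        rewrite -setI_eq0 setIDAC setDIl setDv setI0.
    (* Subtracting the equality for the tight set [A] from Hall's condition for [A :|: B] leaves the
       condition for [B] outside [nbhd A]. *)
    have := hallX (A :|: B);
      rewrite subUset (proper_sub AX) (subset_trans BXA (subsetDl _ _)).
    move=> /(_ isT); rewrite cardsU disjoint_setI0 // cards0 subn0 nbhdU -tightA.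
    have -> : (nbhd A :|: nbhd B) :&: Y =
       (nbhd A :&: Y) :|: (nbhd B :&: (Y :\: nbhd A)).
      apply/setP => u; rewrite !(in_setU, in_setI, in_setD).
      by case: (u \in nbhd A); case: (u \in nbhd B); case: (u \in Y).
    rewrite cardsU => h; have := leq_trans h (leq_subr _ _).
    by rewrite leq_add2l.
  exists (fun y => if y \in A then f y else g y).
  + move=> y z yX zX; case: ifPn => yA; case: ifPn => zA.
    * exact: injf.
    * have /andP[_ rf] := fP _ yA; have := gP z; rewrite !in_setD zA zX =>
      /(_ isT) /andP[/andP[+ _] _] eqfg.
      by rewrite -eqfg; case/negP; apply/nbhdP; exists y.
    * have /andP[_ rf] := fP _ zA; have := gP y; rewrite !in_setD yA yX =>
      /(_ isT) /andP[/andP[+ _] _] eqfg.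
      by rewrite eqfg; case/negP; apply/nbhdP; exists z.
    * by apply: injg; rewrite inE ?yA ?zA.
  + move=> y yX; case: ifPn => yA; first exact: fP.
    by have := gP y; rewrite !in_setD yA yX => /(_ isT) /andP[/andP[_ ->] ->].
- have /set0Pn[y] : nbhd [set x] :&: Y != set0.
    by rewrite -card_gt0 (leq_trans _ (hallX [set x] _)) ?cards1 ?sub1set.
  rewrite in_setI => /andP[/nbhdP[_ /set1P-> rxy] yY].
  have [||f injf fP] := IH (X :\ x) (Y :\ y).
  + by rewrite (cardsD1 x X) xX in ltXk.
  + move=> A AX; have [->|An0] := eqVneq A set0; first by rewrite cards0.
    have pAX : A \proper X by apply: sub_proper_trans AX (properD1 xX).
    have := tightN A An0 pAX; rewrite setIDA (cardsD1 y (nbhd A :&: Y)).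
    by case: (y \in _); rewrite ?add1n ?ltnS //; move/ltnW.
  exists (fun z => if z == x then y else f z).
  + move=> u v uX vX; case: eqVneq => [->|ux]; case: eqVneq => [->|vx] //.
    * by have := fP v; rewrite !in_setD1 vx vX =>
      /(_ isT) /andP[/andP[/eqP ne _] _] yf; case: ne.
    * by have := fP u; rewrite !in_setD1 ux uX =>
      /(_ isT) /andP[/andP[/eqP ne _] _] yf; case: ne.
    * by apply: injf; rewrite in_setD1 ?ux ?vx.
  + move=> u uX; case: eqVneq => [->|ux]; first by rewrite yY.
    by have := fP u; rewrite !in_setD1 ux uX => /(_ isT) /andP[/andP[_ ->] ->].
Qed.

Theorem hall : (forall A, #|A| <= #|nbhd A|)%N ->
  exists s : {perm T}, forall x, r x (s x).
Proof.
move=> hallT; have [A _|f injf fP] := @hall_rec setT setT; first by rewrite setIT.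
have injf' : injective f by move=> x y; apply: injf; rewrite inE.
by exists (perm injf') => x; rewrite permE; have := fP x; rewrite inE => /(_ isT) /andP[].
Qed.

End Hall.

(** * Resampling one coordinate of a random function *)

Section Update.
Variables (I T : finType).
Implicit Types (f : {ffun I -> T}) (D : {set T}).

Definition upd f i v : {ffun I -> T} := [ffun k => if k == i then v else f k].

Lemma updE f i v k : upd f i v k = if k == i then v else f k.
Proof. by rewrite ffunE. Qed.

Lemma upd_on D f i v :
  (upd f i v \in ffun_on (mem D)) && (f i \in D) =
  (f \in ffun_on (mem D)) && (v \in D).
Proof.
apply/andP/andP => -[/ffun_onP fD vD]; split.
- by apply/ffun_onP => k; have := fD k; rewrite updE; case: eqVneq => [->|].
- by have := fD i; rewrite updE eqxx.
- by apply/ffun_onP => k; rewrite updE; case: ifP => // _; apply: fD.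
- exact: fD.
Qed.

Variable R : realFieldType.

Lemma sum_upd D i (h : {ffun I -> T} -> R) :
  #|D|%:R * (\sum_(f in ffun_on (mem D)) h f) =
  \sum_(f in ffun_on (mem D)) \sum_(v in D) h (upd f i v).
Proof.
rewrite mulr_sumr.
under eq_bigr do rewrite mulr_natl -sumr_const.
rewrite !pair_big /=.
(* Exchanging the fresh value with the value of [f] at [i] is an involution on pairs. *)
rewrite (reindex_inj (h := fun p => (upd p.1 i p.2, p.1 i))) /=; last first.
  apply: (can_inj (g := fun p => (upd p.1 i p.2, p.1 i))) => -[f v] /=.
  congr pair; last by rewrite updE eqxx.
  by apply/ffunP => k; rewrite !updE; case: eqVneq => [->|].
by apply: eq_bigl => -[f v] /=; rewrite upd_on.
Qed.

Lemma cardsE_sum (U : finType) (A : {pred U}) : #|A|%:R = \sum_(f in A) 1 :> R.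
Proof. by rewrite sumr_const. Qed.

(** Conditional probability in counting form: fix all coordinates but [i], which decide [Q], and
    average over the remaining one. *)
Lemma card_upd_le D i (Q E : pred {ffun I -> T}) (eps : R) :
  (forall f v, Q (upd f i v) = Q f) ->
  (forall f, f \in ffun_on (mem D) -> Q f ->
     #|[set v in D | E (upd f i v)]|%:R <= eps * #|D|%:R) ->
  #|[set f in ffun_on (mem D) | Q f && E f]|%:R <=
    eps * #|[set f in ffun_on (mem D) | Q f]|%:R.
Proof.
move=> Qi leE; have [D0|Dgt0] := posnP #|D|.
  have fD f : (f \in ffun_on (mem D)) = false.
    apply/negP => /ffun_onP /(_ i); rewrite (cards0_eq D0).
    by rewrite inE.
  rewrite (_ : [set f in _ | _] = set0); last by apply/setP => f; rewrite in_set fD inE.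
  by rewrite (_ : [set f in _ | _] = set0) ?cards0 ?mulr0 //; apply/setP => f;
    rewrite in_set fD inE.
have Dgt : 0 < #|D|%:R :> R by rewrite ltr0n.
rewrite -(ler_pM2l Dgt) !cardsE_sum.
pose h f : R := (Q f && E f)%:R; pose q f : R := (Q f)%:R.
rewrite (_ : \sum_(f in [set f in ffun_on (mem D) | Q f && E f]) 1 =
   \sum_(f in ffun_on (mem D)) h f); last first.
  rewrite big_mkcond [RHS]big_mkcond; apply: eq_bigr => f _; rewrite in_set /h.
  by case: (f \in _); case: (Q f && E f).
rewrite (_ : \sum_(f in [set f in ffun_on (mem D) | Q f]) 1 =
   \sum_(f in ffun_on (mem D)) q f); last first.
  rewrite big_mkcond [RHS]big_mkcond; apply: eq_bigr => f _; rewrite in_set /q.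
  by case: (f \in _); case: (Q f).
rewrite -cardsE_sum (sum_upd _ i) mulrA [_ * eps]mulrC mulr_sumr.
apply: ler_sum => f fD; rewrite /h /q; case: (boolP (Q f)) => Qf; last first.
  by rewrite mulr0 big1 // => v _; rewrite Qi (negPf Qf).
rewrite mulr1; apply: le_trans (leE f fD Qf).
rewrite cardsE_sum [leRHS]big_mkcond [leLHS]big_mkcond; apply: ler_sum => v _.
by rewrite !inE Qi Qf; case: (v \in D); case: (E _).
Qed.

End Update.

(** * Spans of vectors with entries in S *)

Section Subspaces.
Variables (F : fieldType) (S : {fset F}) (n : nat).
Local Notation V := 'rV[S]_n.
Local Notation FV := 'rV[F]_n.
Implicit Types (U W : {vspace FV}) (c : 'I_n -> V) (i : nat).

Lemma dim_full : \dim {:FV} = n.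
Proof. by rewrite dimvf; apply: etrans (dim_matrix _ _ _) (mul1n n). Qed.

Lemma dim_le U : (\dim U <= n)%N.
Proof. by rewrite -[leqRHS]dim_full dimvS ?subvf. Qed.

Lemma neq_fullv U : (U != fullv) = (\dim U < n)%N.
Proof. by rewrite eqEdim subvf dim_full /= ltnNge. Qed.

Lemma dim_addv_line U v : v \notin U -> \dim (U + <[v]>)%VS = (\dim U).+1.
Proof.
move=> vU; have v0 : v != 0 by apply: contraNneq vU => ->; rewrite mem0v.
rewrite dimv_disjoint_sum ?dim_vline ?v0 ?addn1 //; apply/eqP.
rewrite -subv0; apply/subvP => x; rewrite memv_cap => /andP[xU /vlineP[k xE]].
rewrite memv0; apply: contraNT vU => x0.
have k0 : k != 0 by apply: contraNneq x0 => k0; rewrite xE k0 scale0r.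
by rewrite -[v](scalerK k0) -xE memvZ.
Qed.

(* Some [\dim U] of the coordinates determine a vector of [U]. *)
Lemma card_memv U : (#|[set v : V | vecF v \in U]| <= #|{: S}| ^ \dim U)%N.
Proof.
pose A : 'M[F]_(\dim U, n) := \matrix_k tnth (vbasis U) k.
have Afree : row_free A.
  apply: inj_row_free => x xA; apply/rowP => k; rewrite mxE.
  have /freeP/(_ (x 0)) := basis_free (vbasisP U); apply.
  rewrite -[RHS]xA mulmx_sum_row; apply: eq_bigr => j _.
  by rewrite rowK (tnth_nth 0).
have AT : row_full A^T by rewrite /row_full mxrank_tr.
pose f := fullrankfun AT.
have Cunit : colsub f A \in unitmx.
  by rewrite -unitmx_tr trmx_mxsub fullrowsub_unit.
pose h (v : V) : {ffun 'I_(\dim U) -> S} := [ffun k => v 0 (f k)].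
have memA u : u \in U -> exists x : 'rV_(\dim U), u = x *m A.
  move=> uU; exists (\row_k coord (vbasis U) k u).
  rewrite {1}(coord_vbasis uU) mulmx_sum_row; apply: eq_bigr => k _.
  by rewrite mxE rowK (tnth_nth 0).
rewrite -[in leqRHS](card_ord (\dim U)) -card_ffun -(@card_in_imset _ _ h) ?max_card //.
move=> v v'; rewrite !inE => /memA[x vx] /memA[x' vx'] /ffunP hvv'.
have xC : x *m colsub f A = x' *m colsub f A.
  rewrite 2!mulmx_colsub -vx -vx'; apply/rowP => k; rewrite !mxE.
  by have := hvv' k; rewrite !ffunE => ->.
have vv' : vecF v = vecF v' by rewrite vx vx' (can_inj (mulmxK Cunit) xC).
apply/rowP => k; apply: val_inj.
by have /rowP/(_ k) := vv'; rewrite !mxE.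
Qed.

Definition prefix_span c i : {vspace FV} := (\sum_(l < n | (l < i)%N) <[vecF (c l)]>)%VS.

Lemma prefix_span_recr c (i : 'I_n) : prefix_span c i.+1 = (prefix_span c i + <[vecF (c
  i)]>)%VS.
Proof.
rewrite /prefix_span (bigD1 i) //= addvC; congr (_ + _)%VS; apply: eq_bigl => l.
by rewrite ltnS andbC -(inj_eq val_inj) -ltn_neqAle.
Qed.

Lemma prefix_span0 c : prefix_span c 0 = 0%VS.
Proof. by rewrite /prefix_span big_pred0. Qed.

Lemma eq_prefix_span c c' i : (forall l : 'I_n, (l < i)%N -> c l = c' l) -> prefix_span
  c i = prefix_span c' i.
Proof. by move=> cc'; apply: eq_bigr => l li; rewrite cc'. Qed.

Lemma prefix_span_mono c i i' : (i <= i')%N -> (prefix_span c i <= prefix_span c i')%VS.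
Proof.
by move=> ii'; apply/subv_sumP => l li; rewrite (sumv_sup l) ?(leq_trans li).
Qed.

Lemma dim_prefix_span_recr c (i : 'I_n) : \dim (prefix_span c i) = i ->
  (\dim (prefix_span c i.+1) == i.+1) = (vecF (c i) \notin prefix_span c i).
Proof.
move=> di; rewrite prefix_span_recr; case: (boolP (_ \in _)) => ci /=; last first.
  by rewrite dim_addv_line // di eqxx.
by rewrite (addv_idPl _) ?di ?ltn_eqF // -memvE.
Qed.

Lemma dim_prefix_span_le c i : (i <= n)%N -> (\dim (prefix_span c i) <= i)%N.
Proof.
elim: i => [|i IH] lin; first by rewrite prefix_span0 dimv0.
have -> : prefix_span c i.+1 = (prefix_span c i + <[vecF (c (Ordinal lin))]>)%VS.
  by rewrite -(prefix_span_recr _ (Ordinal lin)).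
apply: leq_trans (dimv_add_leqif _ _) _.
by rewrite -[leqRHS]addn1 leq_add ?IH ?(ltnW lin) // dim_vline leq_b1.
Qed.

Lemma dim_prefix_span_pred c (i : 'I_n) : \dim (prefix_span c i.+1) = i.+1 -> \dim
  (prefix_span c i) = i.
Proof.
move=> di; apply/eqP; rewrite eqn_leq dim_prefix_span_le ?(ltnW (ltn_ord i)) //=.
rewrite -ltnS -di prefix_span_recr; apply: leq_trans (dimv_add_leqif _ _) _.
by rewrite -[leqRHS]addn1 leq_add2l dim_vline leq_b1.
Qed.

Lemma prefix_span_basis c : (\dim (prefix_span c n) == n) = basis_of fullv [seq vecF (c
  l) | l <- enum 'I_n].
Proof.
rewrite basisEdim size_map size_enum_ord dim_full leqnn andbT.
have <- : prefix_span c n = <<[seq vecF (c l) | l <- enum 'I_n]>>%VS.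
  rewrite span_def big_map big_enum; apply: eq_bigl => l; exact: ltn_ord.
apply/eqP/idP => [dc|fS]; last by apply/eqP; rewrite eqn_leq dim_le -{1}dim_full dimvS.
by have /eqP -> : prefix_span c n == fullv by rewrite eqEdim subvf dim_full dc leqnn.
Qed.

End Subspaces.

Section UpdateAll.
Variables (R : realFieldType) (I T : finType).

Lemma ffun_onT (f : {ffun I -> T}) : f \in ffun_on (mem [set: T]).
Proof. by apply/ffun_onP => x; rewrite inE. Qed.

Lemma card_upd_leT i (Q E : pred {ffun I -> T}) (eps : R) :
  (forall f v, Q (upd f i v) = Q f) ->
  (forall f, Q f -> #|[set v | E (upd f i v)]|%:R <= eps * #|T|%:R) ->
  #|[set f | Q f && E f]|%:R <= eps * #|[set f | Q f]|%:R.
Proof.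
move=> Qi leE; have := @card_upd_le I T R setT i Q E eps Qi.
rewrite (_ : [set f in _ | Q f && E f] = [set f | Q f && E f]); last first.
  by apply/setP => f; rewrite 2!in_set ffun_onT.
rewrite (_ : [set f in _ | Q f] = [set f | Q f]); last first.
  by apply/setP => f; rewrite 2!in_set ffun_onT.
apply => f _ Qf; rewrite cardsT; apply: le_trans (leE f Qf).
by rewrite ler_nat subset_leq_card //; apply/subsetP => v; rewrite !inE.
Qed.

Lemma sum_updT i (h : {ffun I -> T} -> R) :
  #|T|%:R * (\sum_f h f) = \sum_f \sum_v h (upd f i v).
Proof.
have := sum_upd [set: T] i h; rewrite cardsT.
under eq_bigl do rewrite ffun_onT.
under [X in _ = X -> _]eq_bigl do rewrite ffun_onT.
by move=> ->; apply: eq_bigr => f _; apply: eq_bigl => v; rewrite inE.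
Qed.

End UpdateAll.

(** * Proportions of vectors in a subspace and of ordered bases *)

Section Counting.
Variables (R : realFieldType) (F : fieldType) (S : {fset F}) (n : nat).
Hypothesis S_ge2 : (2 <= #|{: S}|)%N.
Local Notation V := 'rV[S]_n.
Local Notation FV := 'rV[F]_n.
Implicit Types (U W : {vspace FV}) (c : {ffun 'I_n -> V}) (i : nat).

Lemma cardV_gt0 : 0 < #|{: V}|%:R :> R.
Proof. by rewrite ltr0n card_mx expn_gt0 (leq_trans _ S_ge2). Qed.

Lemma memv_count U :
  #|[set v : V | vecF v \in U]|%:R <= 2 ^- (n - \dim U) * #|{: V}|%:R :> R.
Proof.
rewrite mulrC ler_pdivlMr ?exprn_gt0 // -natrX -natrM ler_nat card_mx mul1n.
rewrite -[in leqRHS](subnKC (dim_le U)) expnD.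
rewrite leq_mul ?card_memv //; case: (n - \dim U)%N => // k.
by rewrite leq_exp2r.
Qed.

(** The entries are independent: each one indexed by [A] contributes a factor [2 ^- (n - \dim U)] by
    [memv_count], and the others are free. *)
Lemma all_memv_count (A : {set 'I_n}) U :
  #|[set c : {ffun 'I_n -> V} | [forall a in A, vecF (c a) \in U]]|%:R <=
    2 ^- ((n - \dim U) * #|A|) * #|{: V}|%:R ^+ n :> R.
Proof.
pose fam a : {pred V} := [pred v | (a \in A) ==> (vecF v \in U)].
have -> : #|[set c : {ffun 'I_n -> V} | [forall a in A, vecF (c a) \in U]]| = #|family
  fam|.
  apply: eq_card => c; rewrite in_set; apply/forallP/familyP => h a; have := h a;
    by rewrite inE.
rewrite card_family foldrE big_map big_enum natr_prod /=.
apply: le_trans (_ : \prod_(a < n) ((if a \in A then 2 ^- (n - \dim U) else 1) * #|{: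
  V}|%:R) <= _).
  apply: ler_prod => a _; rewrite ler0n /=.
  case: ifP => aA.
    apply: le_trans (memv_count U); rewrite ler_nat subset_leq_card //.
    by apply/subsetP => v; rewrite !inE aA.
  by rewrite mul1r ler_nat max_card.
rewrite big_split /= prodr_const card_ord -big_mkcond prodr_const.
by rewrite -exprVn -exprM exprVn.
Qed.

Definition indep i : {set {ffun 'I_n -> V}} := [set c : {ffun 'I_n -> V} | \dim
  (prefix_span c i) == i].
Definition ordered_bases := indep n.

Lemma indep_step (i : 'I_n) :
  (1 - 2 ^- (n - i)) * #|indep i|%:R <= #|indep i.+1|%:R :> R.
Proof.
pose E (c : {ffun 'I_n -> V}) := vecF (c i) \in prefix_span c i.
have QE : #|[set c | (c \in indep i) && E c]|%:R <=
    2 ^- (n - i) * #|[set c | c \in indep i]|%:R :> R.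
  have SpU c v : prefix_span (upd c i v) i = prefix_span c i.
    by apply: eq_prefix_span => l li; rewrite updE -val_eqE /= ltn_eqF.
  apply: (@card_upd_leT R _ _ i) => [c v|c]; rewrite inE ?inE ?SpU // => /eqP di.
  rewrite -[X in (n - X)%N]di; apply: le_trans (memv_count _).
  rewrite ler_nat subset_leq_card //; apply/subsetP => v; rewrite !inE /E SpU.
  by rewrite updE eqxx.
have -> : indep i.+1 = indep i :\: [set c | (c \in indep i) && E c].
  apply/setP => c; rewrite !inE negb_and /E; case: (\dim (prefix_span c i) =P i) =>
    [di|ndi] /=.
    by rewrite (dim_prefix_span_recr di) ?andbT.
  by apply/negP => /eqP dc; apply: ndi; apply: dim_prefix_span_pred.
have QEs : [set c | (c \in indep i) && E c] \subset indep i.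
  by apply/subsetP => c; rewrite !inE => /andP[].
rewrite cardsD (setIidPr QEs) natrB ?subset_leq_card //.
rewrite mulrBl mul1r lerB //; apply: le_trans QE _.
by rewrite (_ : [set c | _] = indep i) //; apply/setP => c; rewrite !inE.
Qed.

(** The losses [2 ^- (n - j)] of the steps [j < i] form a geometric series with sum below
    [2 ^- (n - i)]. *)
Lemma card_indep i : (i < n)%N ->
  (1 - 2 ^- (n - i)) * #|{: V}|%:R ^+ n <= #|indep i|%:R :> R.
Proof.
elim: i => [|i IH] lin.
  rewrite (_ : indep _ = setT); last by apply/setP => c; rewrite !inE prefix_span0 dimv0.
  rewrite cardsT card_ffun card_ord natrX ler_piMl ?exprn_ge0 ?ler0n //.
  by rewrite gerBl invr_ge0 exprn_ge0.
apply: le_trans (indep_step (Ordinal (ltnW lin))) => /=.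
have {}IH := IH (ltnW lin).
have qV : #|indep i|%:R <= #|{: V}|%:R ^+ n :> R.
  by rewrite -natrX ler_nat; apply: leq_trans (max_card _) _; rewrite card_ffun card_ord.
have p2 : 2 ^- (n - i.+1) = 2 * 2 ^- (n - i) :> R.
  have -> : (n - i = (n - i.+1).+1)%N by rewrite subnS prednK // subn_gt0 ltnW.
  by rewrite exprS invfM mulrA divff ?mul1r // pnatr_eq0.
have p0 : 0 <= 2 ^- (n - i) :> R by rewrite invr_ge0 exprn_ge0.
have := ler_wpM2l p0 qV; rewrite p2; move: IH; rewrite !mulrBl !mul1r; lra.
Qed.

Lemma card_ordered_bases : #|{: V}|%:R ^+ n <= 4 * #|ordered_bases|%:R :> R.
Proof.
have [n0|n_gt0] := posnP n.
  have -> : ordered_bases = setT.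
    by apply/setP => c; rewrite !inE eqn_leq dim_le [X in (X <= _)%N]n0.
  rewrite cardsT card_ffun card_ord natrX ler_peMl ?exprn_ge0 ?ler0n //.
  by rewrite -[1]/(1%:R) ler_nat.
have lin : (n.-1 < n)%N by rewrite prednK.
(* At least half of the tuples survive the first [n - 1] steps, and at least half of these survive
   the last one. *)
have := card_indep lin; have := indep_step (Ordinal lin).
rewrite /= /ordered_bases [in indep n.-1.+1]prednK // -subn1 subKn // expr1; lra.
Qed.

End Counting.

(** * Spanning and matching probabilities *)

Section Union.
Variable R : realFieldType.

Lemma card_union_le (U I : finType) (K : {pred I}) (P : pred U) (E : I -> pred U) :
  (forall u, P u -> exists2 i, i \in K & E i u) ->
  #|[set u | P u]|%:R <= \sum_(i in K) #|[set u | E i u]|%:R :> R.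
Proof.
move=> PE; rewrite -natr_sum ler_nat.
apply: leq_trans (_ : #|\bigcup_(i in K) [set u | E i u]| <= _)%N.
  apply: subset_leq_card; apply/subsetP => u; rewrite inE => /PE[i iK Eiu].
  by apply/bigcupP; exists i; rewrite ?inE.
elim/big_rec2: _ => [|i s A _ le_sA]; first by rewrite cards0.
by rewrite cardsU; apply: leq_trans (leq_subr _ _) _; rewrite leq_add2l.
Qed.

Lemma subset_of_card (U : finType) (A : {set U}) k : (k <= #|A|)%N ->
  exists2 B : {set U}, B \subset A & #|B| = k.
Proof.
move=> leA; exists [set x in take k (enum A)].
  by apply/subsetP => x; rewrite inE => /mem_take; rewrite mem_enum.
rewrite cardsE; apply: etrans (card_uniqP _) _; first by rewrite take_uniq ?enum_uniq.
by rewrite size_take -cardE; case: ltngtP leA.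
Qed.

Lemma bin_le_exp n k : ('C(n, k) <= n ^ k)%N.
Proof.
apply: leq_trans (_ : n ^_ k <= _)%N.
  by rewrite -bin_ffact leq_pmulr ?fact_gt0.
rewrite ffact_prod -[k in leqRHS]card_ord -prod_nat_const.
by apply: leq_prod => i _; rewrite leq_subr.
Qed.

End Union.

Section SpanningCount.
Variables (R : realFieldType) (F : fieldType) (S : {fset F}) (n : nat).
Hypothesis S_ge2 : (2 <= #|{: S}|)%N.
Local Notation V := 'rV[S]_n.
Local Notation FV := 'rV[F]_n.
Implicit Types (U W : {vspace FV}).

(* Weight [2 ^ codim U] off the full space: it decreases by a factor [3/4] on
   average when a random vector is added to [U]. *)
Definition codim_weight U : R := if U == fullv then 0 else 2 ^+ (n - \dim U).

Lemma codim_weight_ge0 U : 0 <= codim_weight U.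
Proof. by rewrite /codim_weight; case: ifP => // _; rewrite exprn_ge0. Qed.

(** For [U] proper, at least half of the vectors lie outside [U] and these at least halve the
    weight; the others leave it unchanged. The average factor is at most [1/2 + 1/2 * 1/2 = 3/4]. *)
Lemma codim_weight_step U :
  \sum_(v : V) codim_weight (U + <[vecF v]>) <= 3 / 4 * codim_weight U * #|{: V}|%:R.
Proof.
have [->|UnF] := eqVneq U fullv.
  rewrite big1 => [|v _]; first by rewrite !mulr_ge0 ?codim_weight_ge0 ?invr_ge0.
  by rewrite /codim_weight eqEsubv subvf (subv_trans _ (addvSl _ _)).
have dU : (\dim U < n)%N by rewrite -neq_fullv.
set g := codim_weight U; have g0 : 0 <= g by apply: codim_weight_ge0.
have gE : g = 2 ^+ (n - \dim U) by rewrite /g /codim_weight (negPf UnF).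
apply: le_trans (_ : \sum_(v : V) (g / 2 + g / 2 * (vecF v \in U)%:R) <= _).
  apply: ler_sum => v _; have [vU|vU] := boolP (vecF v \in U).
    by rewrite (addv_idPl _) -?memvE // -/g mulr1; lra.
  rewrite mulr0 addr0 {1}/codim_weight; case: ifP => _; first by rewrite divr_ge0.
  by rewrite dim_addv_line // gE subnS -{2}[(n - \dim U)%N]prednK ?subn_gt0 // exprSr
    mulfK ?pnatr_eq0.
rewrite big_split /= sumr_const -mulr_sumr.
have -> : \sum_(v : V) (vecF v \in U)%:R = #|[set v : V | vecF v \in U]|%:R :> R.
  by rewrite -sum1_card natr_sum [RHS]big_mkcond; apply: eq_bigr => v _; rewrite inE;
    case: (_ \in _).
have : #|[set v : V | vecF v \in U]|%:R <= 2^-1 * #|{: V}|%:R :> R.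
  apply: le_trans (memv_count R S_ge2 U) _; rewrite ler_wpM2r ?ler0n //.
  by rewrite lef_pV2 ?posrE ?exprn_gt0 // -{1}[2]expr1 ler_weXn2l ?ler1n // subn_gt0.
rewrite -mulr_natr -[#|xpredT|]/(#|{: V}|) => pV.
have := ler_wpM2l (divr_ge0 g0 (ler0n R 2)) pV; lra.
Qed.

Lemma sum_codim_weight W N : (N <= n)%N ->
  \sum_(c : {ffun 'I_n -> V}) codim_weight (prefix_span c N + W) <=
    (3 / 4) ^+ N * codim_weight W * #|{: V}|%:R ^+ n.
Proof.
have V0 := cardV_gt0 R n S_ge2.
elim: N => [|N IH] Nn.
  under eq_bigr do rewrite prefix_span0 add0v.
  by rewrite sumr_const card_ffun card_ord expr0 mul1r -natrX mulr_natr.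
rewrite -(ler_pM2l V0) (sum_updT (Ordinal Nn)).
apply: le_trans (_ : \sum_(c : {ffun 'I_n -> V}) 3 / 4 * codim_weight (prefix_span c N
  + W) * #|{: V}|%:R <= _).
  apply: ler_sum => c _; apply: le_trans (codim_weight_step _).
  apply: ler_sum => v _; rewrite (prefix_span_recr _ (Ordinal Nn)) updE eqxx.
  rewrite (@eq_prefix_span _ _ _ _ c) => [|l lN];
    last by rewrite updE -val_eqE /= ltn_eqF.
  by rewrite -!addvA [(<[_]> + W)%VS]addvC.
rewrite -mulr_suml -mulr_sumr mulrC ler_pM2l // exprS -!mulrA ler_pM2l ?divr_gt0 //.
by rewrite ler_pM2l ?invr_gt0 ?ltr0n // [_ ^+ N * _]mulrA; apply: IH; apply: ltnW.
Qed.

(** Markov's inequality: the weight is at least 1 on every proper subspace, and its initial value at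
    [W] is at most [2 ^+ w]. *)
Lemma nonspan_count W N w : (N <= n)%N -> (n < \dim W + w)%N ->
  #|[set c : {ffun 'I_n -> V} | (prefix_span c N + W)%VS != fullv]|%:R <=
    2 ^+ w * (3 / 4) ^+ N * #|{: V}|%:R ^+ n :> R.
Proof.
move=> Nn Ww.
apply: le_trans (_ : \sum_(c : {ffun 'I_n -> V}) codim_weight (prefix_span c N + W) <= _).
  rewrite -sum1_card natr_sum big_mkcond; apply: ler_sum => c _;
    rewrite inE /codim_weight.
  by case: eqP => _ /=; rewrite ?lexx // exprn_ege1 // ler1n.
apply: le_trans (sum_codim_weight W Nn) _.
rewrite [_ ^+ w * _]mulrC ler_wpM2r ?exprn_ge0 ?ler0n // ler_wpM2l ?exprn_ge0 ?divr_ge0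
  //.
rewrite /codim_weight; case: ifP => _; first by rewrite exprn_ge0.
by rewrite ler_weXn2l ?ler1n // leq_subLR ltnW.
Qed.

End SpanningCount.

(** * Matching the vectors of one row with given subspaces *)

Section MatchingCount.
Variables (R : realFieldType) (F : fieldType) (S : {fset F}) (n : nat).
Hypothesis S_ge2 : (2 <= #|{: S}|)%N.
Local Notation V := 'rV[S]_n.
Local Notation FV := 'rV[F]_n.
Variable T : 'I_n -> {vspace FV}.

Definition matchable (v : {ffun 'I_n -> V}) : bool :=
  [exists s : {perm 'I_n}, forall j, vecF (v (s j)) \notin T j].

(** A violator [J] of Hall's condition has more than [n - #|J|] entries outside its neighbourhood,
    and these lie in every [T j] with [j] in [J]. The parameter [a] is [n - #|J|]. *)
Lemma not_matchable v : ~~ matchable v ->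
  exists a : 'I_n, exists2 p : {set 'I_n} * {set 'I_n},
    (#|p.1| == n - a)%N && (#|p.2| == a.+1) &
    [forall x in p.2, vecF (v x) \in (\bigcap_(j in p.1) T j)%VS].
Proof.
pose r : rel 'I_n := fun j x => vecF (v x) \notin T j.
move=> nm; case: (boolP [forall J : {set 'I_n}, (#|J| <= #|nbhd r J|)%N]).
  move=> /forallP hallr.
  have [s sP] := hall hallr; case/negP: nm.
  by apply/existsP; exists s; apply/forallP => j; apply: sP.
case/forallPn => J; rewrite -ltnNge => ltJ.
have cN : #|~: nbhd r J| = (n - #|nbhd r J|)%N by rewrite cardsCs setCK card_ord.
have Jn : (#|J| <= n)%N by rewrite -[leqRHS](card_ord n) max_card.
have an : (n - #|J| < n)%N by have := leq_ltn_trans (leq0n _) ltJ; lia.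
have [|A AN cA] := @subset_of_card _ (~: nbhd r J) (n - #|J|).+1.
  by rewrite cN; lia.
exists (Ordinal an), (J, A) => /=; first by rewrite cA subKn ?eqxx.
apply/forall_inP => x xA; rewrite memvE; apply/subv_bigcapP => j jJ; rewrite -memvE.
have := subsetP AN _ xA; rewrite in_setC; apply: contraR => xTj.
by apply/nbhdP; exists j.
Qed.

(** Union bound over the pairs [(J, A)] given by [not_matchable]. If [J] has at least [M] elements,
    codimension [w] gives [2 ^- (w * a.+1)], at most [n ^- (5 * a.+1)], against at most
    [n ^ (2 * a + 1)] pairs. If [J] is smaller, the codimension is only known to be positive, but
    [A] is nearly everything and there are at most [n ^ (2 * M)] pairs. *)
Lemma not_matchable_count M w : (0 < n)%N -> (n ^ 5 <= 2 ^ w)%N ->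
  (forall j, T j != fullv) ->
  (forall J : {set 'I_n}, (M <= #|J|)%N -> (\dim (\bigcap_(j in J) T j) + w <= n)%N) ->
  #|[set v | ~~ matchable v]|%:R <=
    n%:R * (n%:R ^- 4 + n%:R ^+ (2 * M) * 2 ^- (n - M)) * #|{: V}|%:R ^+ n :> R.
Proof.
move=> n_gt0 n5w TnF Tw; have n1 : 1 <= n%:R :> R by rewrite ler1n.
pose E (a : 'I_n) (v : {ffun 'I_n -> V}) := [exists p : {set 'I_n} * {set 'I_n},
  ((#|p.1| == n - a)%N && (#|p.2| == a.+1)) &&
    [forall x in p.2, vecF (v x) \in (\bigcap_(j in p.1) T j)%VS]].
apply: le_trans (@card_union_le R _ _ predT _ E _) _ => [v /not_matchable[a [p p1 p2]]|].
  by exists a => //; apply/existsP; exists p; rewrite p1.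
set B := (X in _ <= _ * X * _).
apply: le_trans (_ : \sum_(a < n) B * #|{: V}|%:R ^+ n <= _); last first.
  by rewrite sumr_const card_ord -[leLHS]mulr_natl mulrA.
apply: ler_sum => a _.
pose K : {set {set 'I_n} * {set 'I_n}} :=
  setX [set J : {set 'I_n} | #|J| == n - a]%N [set A : {set 'I_n} | #|A| == a.+1].
pose E' (p : {set 'I_n} * {set 'I_n}) (v : {ffun 'I_n -> V}) :=
  [forall x in p.2, vecF (v x) \in (\bigcap_(j in p.1) T j)%VS].
apply: le_trans (@card_union_le R _ _ (mem K) _ E' _) _ => [v /existsP[p /andP[p1 p2]]|].
  by exists p => //; rewrite !inE.
pose d := if (M <= n - a)%N then w else 1%N.
apply: le_trans (_ : \sum_(p in K) 2 ^- (d * a.+1) * #|{: V}|%:R ^+ n <= _).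
  apply: ler_sum => -[J A]; rewrite !inE /= => /andP[/eqP cJ /eqP cA].
  apply: le_trans (all_memv_count R S_ge2 A _) _; rewrite cA.
  rewrite ler_wpM2r ?exprn_ge0 // lef_pV2 ?posrE ?exprn_gt0 // ler_weXn2l ?ler1n //.
  rewrite leq_mul2r /= /d; case: ifP => Mna.
    by rewrite leq_subRL ?dim_le //; have := Tw J; rewrite cJ; apply.
  have /card_gt0P[j jJ] : (0 < #|J|)%N by rewrite cJ subn_gt0.
  rewrite subn_gt0; apply: leq_ltn_trans (_ : \dim (T j) < n)%N;
    last by rewrite -neq_fullv.
  by rewrite dimvS // (bigcapv_inf j).
rewrite sumr_const -[leLHS]mulr_natl mulrA ler_wpM2r ?exprn_ge0 //.
have -> : #|K| = ('C(n, a) * 'C(n, a.+1))%N.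
  by rewrite /K cardsX !card_draws card_ord bin_sub // ltnW.
have n0 : 0 < n%:R :> R by rewrite ltr0n.
rewrite ler_pdivrMr ?exprn_gt0 // /B /d; case: ifP => Mna.
  rewrite mulrDl ler_wpDr //; first by rewrite !mulr_ge0 ?exprn_ge0 ?invr_ge0 ?exprn_ge0.
  rewrite mulrC ler_pdivlMr ?exprn_gt0 // -!natrX -natrM ler_nat.
  apply: leq_trans (_ : (n ^ 5) ^ a.+1 <= _)%N; last by rewrite expnM leq_exp2r.
  apply: leq_trans (_ : n ^ a * n ^ a.+1 * n ^ 4 <= _)%N.
    by rewrite leq_mul // leq_mul // bin_le_exp.
  rewrite -!expnD -expnM leq_pexp2l //; lia.
rewrite mulrDl ler_wpDl //; first by rewrite mulr_ge0 ?exprn_ge0 ?invr_ge0 ?exprn_ge0.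
rewrite mul1n mulrAC ler_pdivlMr ?exprn_gt0 // -!natrX -!natrM ler_nat.
apply: leq_mul; last by rewrite leq_pexp2l //; lia.
(* Here [n - a < M], so the binomials are bounded through the complementary subsets. *)
apply: leq_trans (_ : n ^ (n - a) * n ^ (n - a.+1) <= _)%N.
  rewrite -(bin_sub (ltnW (ltn_ord a))) -(bin_sub (ltn_ord a)).
  by apply: leq_mul; apply: bin_le_exp.
rewrite -expnD leq_pexp2l //; lia.
Qed.

End MatchingCount.

(** * Spread families of columns *)

(** Greedy choice: as long as some [T j] does not contain the current intersection, adding it lowers
    the dimension. After [w] such steps the codimension would be at least [w], against the
    hypothesis, so the process stops earlier. *)
Lemma bigcapv_select (F : fieldType) (n : nat) (T : 'I_n -> {vspace 'rV[F]_n})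
    (J : {set 'I_n}) (w : nat) :
  J != set0 -> (n < \dim (\bigcap_(j in J) T j) + w)%N ->
  exists2 t : w.-tuple 'I_n, {subset t <= J} &
    forall j, j \in J -> (\bigcap_(r < w) T (tnth t r) <= T j)%VS.
Proof.
move=> /set0Pn[j0 j0J] dJ; pose cap s := (\bigcap_(j <- s) T j)%VS.
have capJ s : {subset s <= J} -> (\bigcap_(j in J) T j <= cap s)%VS.
  rewrite /cap; elim: s => [|j s IH] sJ; first by rewrite big_nil subvf.
  rewrite big_cons subv_cap (bigcapv_inf j) ?sJ ?mem_head //=.
  by apply: IH => x xs; rewrite sJ // in_cons xs orbT.
suff [s [sw sJ capw]] : exists s : seq 'I_n, [/\ size s = w, {subset s <= J} &
    (forall j, j \in J -> (cap s <= T j)%VS) \/ (\dim (cap s) + w <= n)%N].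
  exists (Tuple (introT eqP sw)) => // j jJ; rewrite -(big_tuple _ _ (Tuple _) predT T).
  case: capw => [/(_ j jJ)//|]; rewrite leqNgt => /negP[].
  by apply: leq_trans dJ _; rewrite leq_add2r dimvS // capJ.
elim: w {dJ} => [|r [s [sr sJ IH]]].
  by exists [::]; split=> //; right; rewrite addn0 /cap big_nil dim_le.
have [/forall_inP all_le|/forall_inPn[j jJ nle]] := boolP [forall j in J, cap s <= T
  j]%VS.
  (* The intersection is already inside every [T j]; [j0] only pads the list to the required
     length. *)
  exists (j0 :: s); split; first by rewrite /= sr.
    by move=> x; rewrite in_cons => /predU1P[->|/sJ].
  by left=> j jJ; rewrite /cap big_cons (subv_trans (capvSr _ _)) ?all_le.
have dr : (\dim (cap s) + r <= n)%N.
  by case: IH => // /(_ j jJ); rewrite (negPf nle).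
exists (j :: s); split; first by rewrite /= sr.
  by move=> x; rewrite in_cons => /predU1P[->|/sJ].
right; apply: leq_trans dr; rewrite addnS -addSn leq_add2r.
rewrite ltn_neqAle dimvS /cap ?big_cons ?capvSr // andbT.
apply: contra nle => /eqP dE; have /eqP <- : (T j :&: cap s)%VS == cap s.
  by rewrite eqEdim capvSr /= dE.
exact: capvSl.
Qed.

Section Spread.
Variables (F : fieldType) (S : {fset F}) (n N w m : nat).
Local Notation V := 'rV[S]_n.
Local Notation K := {ffun 'I_n -> V}.
Local Notation k := (n - N)%N.
Local Notation idx := (w.-tuple ('I_n * k.-tuple V)).
Hypothesis Nn : (N <= n)%N.
Implicit Types (C : {ffun 'I_n -> K}) (i : nat) (x : idx).

(** The default [c l] is never reached when [u] has length [n - N]: the tail then replaces all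
    entries from row [N] on. *)
Definition mix (c : K) (u : seq V) : K :=
  [ffun l : 'I_n => if (l < N)%N then c l else nth (c l) u (l - N)].

Definition mixcap C x i : {vspace 'rV[F]_n} :=
  (\bigcap_(r < w) prefix_span (mix (C (tnth x r).1) (tnth x r).2) i)%VS.

(** Columns named in [x] are excluded, since [mixcap] depends on them. *)
Definition badcols C x i : {set 'I_n} :=
  [set j | (j \notin map fst x) && ((prefix_span (C j) N + mixcap C x i)%VS != fullv)].

(* [mixcap C x i] is the intersection of the spans of [w] columns whose entries
   below row [N] have been replaced arbitrarily; it only depends on [C] through
   these columns, so that the other columns remain independent of it. *)
Definition spread C : bool :=
  [forall i : 'I_n, forall x,
    (n < \dim (mixcap C x i) + w)%N ==> (#|badcols C x i| < m)%N].

Lemma eq_mixcap C C' x i :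
  (forall j, j \in map fst x -> forall l : 'I_n, (l < N)%N -> C j l = C' j l) ->
  mixcap C x i = mixcap C' x i.
Proof.
move=> CC'; apply: eq_bigr => r _.
suff -> : mix (C (tnth x r).1) (tnth x r).2 = mix (C' (tnth x r).1) (tnth x r).2 by [].
apply/ffunP => l; rewrite !ffunE; case: ltnP => lN.
  by apply: CC' => //; apply: map_f; apply: mem_tnth.
by apply: set_nth_default; rewrite size_tuple ltn_sub2r // (leq_ltn_trans lN).
Qed.

(** Consequently, resampling a row of index at least [N] preserves the spread condition. *)
Lemma eq_spread C C' :
  (forall j (l : 'I_n), (l < N)%N -> C j l = C' j l) -> spread C = spread C'.
Proof.
move=> CC'; apply: eq_forallb => i; apply: eq_forallb => x.
have mC : mixcap C x i = mixcap C' x i by apply: eq_mixcap => j _; apply: CC'.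
rewrite /badcols mC; congr (_ ==> (_ < _)%N); apply: eq_card => j.
by rewrite !inE (@eq_prefix_span _ _ _ (C j) (C' j)) // => l; apply: CC'.
Qed.

Variable R : realFieldType.
Hypothesis S_ge2 : (2 <= #|{: S}|)%N.
Let delta : R := 2 ^+ w * (3 / 4) ^+ N.

(** Resample the columns of [s] one at a time. None is named in [x], so each is independent of
    [mixcap] and of the other columns, and [nonspan_count] yields a factor [delta]. *)
Lemma nonspanning_columns_count x (i : 'I_n) (s : seq 'I_n) :
  uniq s -> all (fun j => j \notin map fst x) s ->
  #|[set C | (n < \dim (mixcap C x i) + w)%N &&
      all (fun j => (prefix_span (C j) N + mixcap C x i)%VS != fullv) s]|%:R <=
    delta ^+ size s * #|{: K}|%:R ^+ n.
Proof.
elim: s => [|j s IH] /=.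
  move=> _ _; rewrite mul1r -natrX ler_nat; apply: leq_trans (max_card _) _.
  by rewrite card_ffun card_ord.
move=> /andP[js us] /andP[jx sx].
pose Q C := (n < \dim (mixcap C x i) + w)%N &&
      all (fun j => (prefix_span (C j) N + mixcap C x i)%VS != fullv) s.
pose E C := (prefix_span (C j) N + mixcap C x i)%VS != fullv.
have mU C v : mixcap (upd C j v) x i = mixcap C x i.
  by apply: eq_mixcap => j' j'x l _; rewrite updE; case: eqP j'x jx => // -> ->.
have -> : [set C | (n < \dim (mixcap C x i) + w)%N
  && (((prefix_span (C j) N + mixcap C x i)%VS != fullv)
      && all (fun j => (prefix_span (C j) N + mixcap C x i)%VS != fullv) s)] =
   [set C | Q C && E C].
  by apply/setP => C; rewrite !inE /Q /E -andbA; congr andb; rewrite andbC.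
apply: le_trans (@card_upd_leT R _ _ j Q E delta _ _) _.
- move=> C v; rewrite /Q mU; congr andb; apply: eq_in_all => j' j's.
  by rewrite updE; case: (j' =P j) => // jj'; rewrite -jj' j's in js.
- move=> C /andP[dW _]; rewrite card_ffun card_ord natrX.
  apply: le_trans (nonspan_count R S_ge2 Nn dW); rewrite ler_nat subset_leq_card //.
  by apply/subsetP => v; rewrite !inE /E mU updE eqxx.
rewrite exprS -mulrA ler_wpM2l ?IH //.
by rewrite mulr_ge0 ?exprn_ge0 // divr_ge0.
Qed.

(** Union bound over the row [i] ([n] choices), the columns and tails in [x] ([(n * #|V| ^ k) ^ w]
    choices) and the set of bad columns (at most [2 ^ n]). As [delta <= 1], a bad set with more than
    [m] elements is no worse than one with [m]. *)
Lemma not_spread_count : delta <= 1 ->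
  #|[set C | ~~ spread C]|%:R <=
    (n * (n * #|{: V}| ^ k) ^ w * 2 ^ n)%:R * delta ^+ m * #|{: K}|%:R ^+ n :> R.
Proof.
move=> d1; have d0 : 0 <= delta by rewrite mulr_ge0 ?exprn_ge0 // divr_ge0.
pose P (p : 'I_n * idx * {set 'I_n}) := (m <= #|p.2|)%N && all (fun j =>
  j \notin map fst p.1.2) (enum p.2).
pose E (p : 'I_n * idx * {set 'I_n}) C := (n < \dim (mixcap C p.1.2 p.1.1) + w)%N &&
      all (fun j => (prefix_span (C j) N + mixcap C p.1.2 p.1.1)%VS != fullv) (enum p.2).
apply: le_trans (@card_union_le R _ _ P _ E _) _ => [C|].
  move=> /forallPn[i /forallPn[x]]; rewrite negb_imply -leqNgt => /andP[dW mb].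
  exists (i, x, badcols C x i).
    by rewrite unfold_in mb; apply/allP => j; rewrite mem_enum inE => /andP[].
  by rewrite /E dW; apply/allP => j; rewrite mem_enum inE => /andP[].
apply: le_trans (_ : \sum_(p in P) delta ^+ m * #|{: K}|%:R ^+ n <= _).
  apply: ler_sum => -[[i x] J] /andP[/= mJ Jx].
  apply: le_trans (nonspanning_columns_count i (enum_uniq _) Jx) _.
  by rewrite ler_wpM2r ?exprn_ge0 // -cardE ler_wiXn2l.
rewrite sumr_const -[leLHS]mulr_natl -!mulrA ler_wpM2r ?mulr_ge0 ?exprn_ge0 //.
rewrite ler_nat; apply: leq_trans (max_card _) _.
have c2 : #|{: {set 'I_n}}| = (2 ^ n)%N.
  by rewrite -cardsT -powersetT card_powerset cardsT card_ord.
by rewrite !card_prod c2 !card_tuple !card_prod card_tuple card_ord.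
Qed.

End Spread.

(** * Row by row construction *)

Section Rows.
Variables (F : fieldType) (S : {fset F}) (n N w m : nat).
Local Notation V := 'rV[S]_n.
Local Notation K := {ffun 'I_n -> V}.
Hypothesis Nn : (N <= n)%N.
Implicit Types (om : {ffun 'I_n -> K}) (sg : {ffun 'I_n -> {perm 'I_n}}) (i : nat).

Definition columns om : {ffun 'I_n -> K} := [ffun j => [ffun l => om l j]].

Lemma columnsK : involutive columns.
Proof. by move=> om; apply/ffunP => j; apply/ffunP => l; rewrite !ffunE. Qed.

Definition arranged om sg (j : 'I_n) : K := [ffun l => om l (sg l j)].

(** Keeping the identity in the first [N] rows makes the transversals agree there with the columns
    of [om], to which the spread condition refers. *)
Definition arrangeable om i : bool :=
  [exists sg : {ffun 'I_n -> {perm 'I_n}},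
    [forall l : 'I_n, (l < N)%N ==> (sg l == 1%g)] &&
    [forall j, \dim (prefix_span (arranged om sg j) i) == i]].

Lemma arrangeable0 om : arrangeable om 0.
Proof.
apply/existsP; exists [ffun=> 1%g]; apply/andP; split; apply/forallP => j.
  by rewrite ffunE eqxx implybT.
by rewrite prefix_span0 dimv0.
Qed.

Lemma arranged_upd om sg (i : 'I_n) v s j :
  prefix_span (arranged (upd om i v) (upd sg i s) j) i = prefix_span (arranged om sg j) i.
Proof. by apply: eq_prefix_span => l li; rewrite !ffunE -val_eqE /= ltn_eqF. Qed.

Lemma arranged_updl om sg (i : 'I_n) v j :
  prefix_span (arranged (upd om i v) sg j) i = prefix_span (arranged om sg j) i.
Proof. by apply: eq_prefix_span => l li; rewrite !ffunE -val_eqE /= ltn_eqF. Qed.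

Lemma arrangeable_upd om (i : 'I_n) v : arrangeable (upd om i v) i = arrangeable om i.
Proof.
apply: eq_existsb => sg; congr andb; apply: eq_forallb => j.
by rewrite arranged_updl.
Qed.

Lemma spread_columns_upd om (i : 'I_n) v :
  ((N <= i)%N ==> spread N w m (columns (upd om i v))) =
  ((N <= i)%N ==> spread N w m (columns om)).
Proof.
apply: implyb_id2l => Ni; apply: eq_spread => j l lN; rewrite !ffunE.
by case: (l =P i) => // li; move: lN; rewrite li ltnNge Ni.
Qed.

Lemma arrangeable_next om sg (i : 'I_n) (v : K) (s : {perm 'I_n}) :
  (forall l : 'I_n, (l < N)%N -> sg l = 1%g) -> ((i < N)%N -> s = 1%g) ->
  (forall j, \dim (prefix_span (arranged om sg j) i) = i) ->
  (forall j, vecF (v (s j)) \notin prefix_span (arranged om sg j) i) ->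
  arrangeable (upd om i v) i.+1.
Proof.
move=> sg1 s1 dsg vs; apply/existsP; exists (upd sg i s); apply/andP; split.
  apply/forallP => l; apply/implyP => lN; rewrite updE.
  by case: (l =P i) => [li|_]; rewrite ?s1 ?sg1 -?li.
apply/forallP => j; rewrite dim_prefix_span_recr arranged_upd //.
by rewrite !ffunE !eqxx vs.
Qed.

(** Otherwise [bigcapv_select] finds [w] indices in [J] whose spans meet inside every [T_j], [j] in
    [J], where [T_j] is the current span. This meet is a [mixcap] whose tails are the actual entries
    of the transversals. For each other [j] in [J], the first [N] entries and the meet both lie in
    [T_j], of dimension at most [i < n]. So at least [m] columns are bad, contradicting [spread]. *)
Lemma spread_bigcap om sg i (J : {set 'I_n}) : (N <= i < n)%N ->
  (forall l : 'I_n, (l < N)%N -> sg l = 1%g) ->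
  spread N w m (columns om) -> J != set0 -> (w + m <= #|J|)%N ->
  (\dim (\bigcap_(j in J) prefix_span (arranged om sg j) i) + w <= n)%N.
Proof.
move=> /andP[Ni ilt] sg1 spr J0 cJ; rewrite leqNgt; apply/negP => dJ.
have [t tJ capt] := bigcapv_select J0 dJ.
pose tl j := [seq arranged om sg j l | l <- drop N (enum 'I_n)].
have tl_size j : size (tl j) == (n - N)%N by rewrite size_map size_drop size_enum_ord.
have mixE j : mix N (columns om j) (tl j) = arranged om sg j.
  apply/ffunP => l; rewrite ffunE; case: ltnP => lN.
    by rewrite !ffunE sg1 // perm1.
  have lnN : (l - N < size (drop N (enum 'I_n)))%N.
    by rewrite size_drop size_enum_ord ltn_sub2r // (leq_ltn_trans lN).
  by rewrite (nth_map l) // nth_drop subnKC // nth_ord_enum.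
pose x := [tuple of map (fun j => (j, Tuple (tl_size j))) t].
have xE : mixcap (columns om) x i = (\bigcap_(r < w) prefix_span (arranged om sg (tnth
  t r)) i)%VS.
  by apply: eq_bigr => r _; rewrite tnth_map mixE.
have x1 : map fst x = t by rewrite -map_comp map_id_in.
have := forallP (forallP spr (Ordinal ilt)) x; rewrite xE.
have -> : (n < \dim (\bigcap_(r < w) prefix_span (arranged om sg (tnth t r)) i) + w)%N.
  apply: leq_trans dJ _; rewrite leq_add2r dimvS //; apply/subv_bigcapP => r _.
  by rewrite (bigcapv_inf (tnth t r)) // tJ // mem_tnth.
rewrite implyTb; apply/negP; rewrite -leqNgt.
apply: leq_trans (_ : #|J :\: [set j in t]| <= _)%N.
  have : (#|[set j in t]| <= w)%N by rewrite cardsE (leq_trans (card_size _)) ?size_tuple.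
  move=> ct; rewrite cardsD -[m](addKn w) leq_sub //.
  exact: leq_trans (subset_leq_card (subsetIr _ _)) ct.
apply: subset_leq_card; apply/subsetP => j; rewrite !inE => /andP[jt jJ].
rewrite x1 jt /= neq_fullv xE; apply: (leq_ltn_trans _ ilt).
apply: leq_trans (dim_prefix_span_le (arranged om sg j) (ltnW ilt)).
rewrite dimvS // subv_add capt // andbT.
apply: subv_trans (prefix_span_mono _ Ni);
  rewrite (@eq_prefix_span _ _ _ _ (arranged om sg j)) // => l lN.
by rewrite !ffunE sg1 // perm1.
Qed.

Variable R : realFieldType.
Hypothesis S_ge2 : (2 <= #|{: S}|)%N.

(** With the identity permutation only [n] incidences can go wrong, each with proportion
    [2 ^- (n - i)]; the factor 4 is the cost of restricting row [i] to ordered bases. *)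
Lemma first_rows_count om (i : 'I_n) : (i < N)%N -> arrangeable om i ->
  #|[set v in ordered_bases S n | ~~ arrangeable (upd om i v) i.+1]|%:R <=
    (4 * n%:R * 2 ^- (n - i)) * #|ordered_bases S n|%:R :> R.
Proof.
move=> iN /existsP[sg /andP[/forall_inP sg1 /forallP dsg]].
have {}sg1 (l : 'I_n) : (l < N)%N -> sg l = 1%g by move=> /sg1 /eqP.
pose E j (v : K) := [forall a in [set j], vecF (v a) \in prefix_span (arranged om sg j)
  i].
apply: le_trans (_ : #|[set v | ~~ arrangeable (upd om i v) i.+1]|%:R <= _).
  by rewrite ler_nat subset_leq_card //; apply/subsetP => v; rewrite !inE => /andP[].
apply: le_trans (@card_union_le R _ _ predT _ E _) _ => [v nv|].
  apply/exists_inP; apply: contraNT nv => /existsPn vT.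
  apply: (@arrangeable_next om sg i v 1%g) => // [j|j]; first exact/eqP.
  rewrite perm1; have := vT j; rewrite andTb; apply: contra => vTj.
  by apply/forall_inP => a /set1P ->.
apply: le_trans (_ : \sum_(j < n) 2 ^- (n - i) * #|{: V}|%:R ^+ n <= _).
  apply: ler_sum => j _; apply: le_trans (all_memv_count R S_ge2 _ _) _.
  by rewrite cards1 muln1 (eqP (dsg j)).
rewrite sumr_const card_ord -[leLHS]mulr_natl.
rewrite [4 * _]mulrC -!mulrA ler_wpM2l // [leRHS]mulrCA ler_wpM2l ?invr_ge0 ?exprn_ge0 //.
exact: card_ordered_bases.
Qed.

Lemma last_rows_count om (i : 'I_n) : (N <= i)%N -> (0 < w + m)%N -> (n ^ 5 <= 2 ^ w)%N ->
  arrangeable om i && spread N w m (columns om) ->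
  #|[set v in ordered_bases S n | ~~ arrangeable (upd om i v) i.+1]|%:R <=
    (4 * n%:R * (n%:R ^- 4 + n%:R ^+ (2 * (w + m)) * 2 ^- (n - (w + m)))) *
      #|ordered_bases S n|%:R :> R.
Proof.
move=> Ni wm0 n5 /andP[/existsP[sg /andP[/forall_inP sg1 /forallP dsg]] spr].
have {}sg1 (l : 'I_n) : (l < N)%N -> sg l = 1%g by move=> /sg1 /eqP.
pose T j := prefix_span (arranged om sg j) i.
apply: le_trans (_ : #|[set v | ~~ matchable T v]|%:R <= _).
  rewrite ler_nat; apply: subset_leq_card; apply/subsetP => v; rewrite !inE => /andP[_].
  apply: contra => /existsP[s /forallP sT].
  by apply: (@arrangeable_next om sg i v s) => // [iN|j];
    [rewrite ltnNge Ni in iN | apply/eqP].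
have n0 : (0 < n)%N by apply: leq_ltn_trans (ltn_ord i).
apply: le_trans (not_matchable_count R S_ge2 n0 n5 (M := w + m) _ _) _.
- by move=> j; rewrite neq_fullv (eqP (dsg j)).
- move=> J cJ; apply: spread_bigcap => //; first by rewrite Ni ltn_ord.
  by rewrite -card_gt0 (leq_trans wm0).
rewrite [4 * _]mulrC -!mulrA ler_wpM2l // [leRHS]mulrCA ler_wpM2l ?card_ordered_bases //.
by rewrite addr_ge0 ?mulr_ge0 ?invr_ge0 ?exprn_ge0.
Qed.

(** Either the columns are not spread, or some row is the first that cannot be added. The first
    event involves all rows at once and pays [4 ^+ n] for passing from arbitrary rows to bases; a
    failure at row [i] is conditional on the other rows and pays only 4. *)
Lemma not_arrangeable_count : (0 < w + m)%N -> (n ^ 5 <= 2 ^ w)%N ->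
  2 ^+ w * (3 / 4) ^+ N <= 1 :> R ->
  #|[set om in ffun_on (mem (ordered_bases S n)) | ~~ arrangeable om n]|%:R <=
    ((n * (n * #|{: V}| ^ (n - N)) ^ w * 2 ^ n)%:R * (2 ^+ w * (3 / 4) ^+ N) ^+ m * 4 ^+ n
      + \sum_(i < n) 4 * n%:R * (if (i < N)%N then 2 ^- (n - i) else
           n%:R ^- 4 + n%:R ^+ (2 * (w + m)) * 2 ^- (n - (w + m)))) *
    #|ordered_bases S n|%:R ^+ n :> R.
Proof.
move=> wm0 n5 d1; set OM := ffun_on _.
(* For [i < N] the spread condition is omitted, because it involves row [i], which has to stay free
   for resampling. *)
pose E (o : option 'I_n) om := (om \in OM) && if o is Some i then
    (arrangeable om i && ((N <= i)%N ==> spread N w m (columns om)))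
      && ~~ arrangeable om i.+1
  else ~~ spread N w m (columns om).
apply: le_trans (@card_union_le R _ _ predT _ E _) _ => [om /andP[omO nom]|].
  have [spr|nspr] := boolP (spread N w m (columns om)); last by exists None;
    rewrite // /E omO.
  suff [i ai ni] : exists2 i : 'I_n, arrangeable om i & ~~ arrangeable om i.+1.
    by exists (Some i) => //; rewrite /E omO ai spr implybT ni.
  apply/exists_inP; apply: contraNT nom => /exists_inPn step.
  suff : forall i, (i <= n)%N -> arrangeable om i by apply.
  elim=> [_|i IH lin]; first exact: arrangeable0.
  by have := step (Ordinal lin) (IH (ltnW lin)); rewrite negbK.
have OMc : #|OM| = (#|ordered_bases S n| ^ n)%N by rewrite /OM card_ffun_on card_ord.
rewrite mulrDl (bigD1 None) //=; apply: lerD.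
  apply: le_trans (_ : #|[set C | ~~ spread N w m C]|%:R <= _).
    rewrite ler_nat; apply: leq_trans (leq_imset_card columns _); apply: subset_leq_card.
    apply/subsetP => om; rewrite inE => /andP[_ nspr]; apply/imsetP.
    by exists (columns om); rewrite ?columnsK // inE.
  apply: le_trans (not_spread_count m Nn S_ge2 d1) _.
  rewrite -!mulrA; do 2 (rewrite ler_wpM2l ?exprn_ge0 ?mulr_ge0 ?exprn_ge0 ?divr_ge0 //).
  rewrite -exprMn card_ffun card_ord natrX lerXn2r ?nnegrE ?mulr_ge0 ?exprn_ge0 //.
  exact: card_ordered_bases.
rewrite mulr_suml (reindex_omap Some id) /=; last by case.
rewrite (eq_bigl predT); last by move=> i; rewrite /= eqxx.
apply: ler_sum => i _.
pose Q om := arrangeable om i && ((N <= i)%N ==> spread N w m (columns om)).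
pose Z om := ~~ arrangeable om i.+1.
set e := 4 * _ * _.
have -> : #|[set om | E (Some i) om]| = #|[set om in OM | Q om && Z om]|.
  by apply: eq_card => om; rewrite !inE.
apply: le_trans (@card_upd_le _ _ R (ordered_bases S n) i Q Z e _ _) _.
- by move=> om v;
  apply: (f_equal2 andb (arrangeable_upd om i v) (spread_columns_upd om i v)).
- move=> om _ /andP[ai spr]; rewrite /e; case: ltnP => iN; first exact: first_rows_count.
  by apply: last_rows_count => //; rewrite ai (implyP spr).
rewrite -natrX -OMc ler_wpM2l //; last first.
  by rewrite ler_nat; apply: subset_leq_card; apply/subsetP => om; rewrite inE => /andP[].
rewrite /e !mulr_ge0 //; case: ifP => _; first by rewrite invr_ge0 exprn_ge0.
by rewrite addr_ge0 ?mulr_ge0 ?invr_ge0 ?exprn_ge0.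
Qed.

End Rows.

(** * Ordered and unordered bases *)

Section OrderedBases.
Variables (F : fieldType) (S : {fset F}) (n : nat).
Local Notation V := 'rV[S]_n.
Local Notation K := {ffun 'I_n -> V}.
Implicit Types (c : K) (om : {ffun 'I_n -> K}) (B : {set V}).

Lemma ordered_bases_inj c : c \in ordered_bases S n -> injective c.
Proof.
rewrite inE prefix_span_basis => /basis_free/free_uniq uc.
have : injectiveb c.
  by rewrite /injectiveb /dinjectiveb; apply: (map_uniq (f := @vecF F S n));
    rewrite -map_comp.
by move/injectiveP.
Qed.

Lemma ordered_bases_imset c : injective c -> (c \in ordered_bases S n) = (c @: setT \in
  bases S n).
Proof.
move=> injc;
  rewrite [LHS]inE [RHS]inE prefix_span_basis (_ : [seq vecF (c l) | l <- enum 'I_n] =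
  [seq vecF v | v <- [seq c l | l <- enum 'I_n]]); last by rewrite -map_comp.
apply: perm_basis; apply: perm_map; apply: uniq_perm.
- by rewrite map_inj_uniq ?enum_uniq.
- exact: enum_uniq.
move=> v; rewrite mem_enum; apply/mapP/imsetP => -[l _ ->]; exists l => //.
by rewrite mem_enum.
Qed.

Lemma card_bases B : B \in bases S n -> #|B| = n.
Proof.
rewrite inE => bB; have := @size_basis _ _ _ _ (in_tuple _) bB.
by rewrite dim_full size_map -cardE => <-.
Qed.

Lemma card_orderings B :
  #|[set c in ordered_bases S n | c @: setT == B]| = if B \in bases S n then n`! else 0%N.
Proof.
case: ifPn => [Bb|/negP nBb]; last first.
  apply/eqP; rewrite cards_eq0; apply/eqP/setP => c; rewrite !in_set0 in_set.
  apply/negP => /andP[cO /eqP cB]; apply: nBb.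
  by rewrite -cB -ordered_bases_imset //; apply: ordered_bases_inj.
have <- : #|[set c : K in ffun_on (mem B) | injectiveb c]| = n`!.
  by rewrite card_inj_ffuns_on (card_bases Bb) card_ord ffactnn.
apply: eq_card => c; rewrite !in_set; apply/andP/andP => -[].
  move=> cO /eqP cB; split; last by apply/injectiveP; apply: ordered_bases_inj;
    rewrite inE.
  by apply/ffun_onP => j; rewrite -cB; apply: imset_f.
move=> /ffun_onP cB /injectiveP injc.
have cE : c @: setT = B.
  apply/eqP; rewrite eqEcard card_imset // cardsT card_ord (card_bases Bb) leqnn andbT.
  by apply/subsetP => _ /imsetP[j _ ->]; apply: cB.
by rewrite cE eqxx; have := ordered_bases_imset injc; rewrite cE Bb inE => ->.
Qed.

Lemma card_ordered_bases_eq : #|ordered_bases S n| = (n`! * #|bases S n|)%N.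
Proof.
rewrite -sum1_card (partition_big (fun c : K => c @: setT) predT) //=.
rewrite (eq_bigr (fun B => if B \in bases S n then n`! else 0%N)) => [|B _].
  by rewrite -big_mkcond sum_nat_const mulnC.
by rewrite sum1dep_card -card_orderings; apply: eq_card => c; rewrite !inE.
Qed.

Definition base_sets om : {ffun 'I_n -> {set V}} := [ffun i => om i @: setT].

(** Each basis has exactly [n!] orderings, so forgetting the order of a uniform ordered basis gives
    a uniform basis. *)
Lemma indep_prob_uniform (R : realType) (E : pred {ffun 'I_n -> {set V}}) :
  indep_prob (fun _ : 'I_n =>
    @uniform_pmf R _ (bases S n)) E * #|ordered_bases S n|%:R ^+ n =
  #|[set om in ffun_on (mem (ordered_bases S n)) | E (base_sets om)]|%:R.
Proof.
set A := [set om in _ | _].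
rewrite -(sum1_card (mem A)) (partition_big base_sets E) => [|om];
  last by rewrite in_set => /andP[].
rewrite natr_sum /indep_prob mulr_suml; apply: eq_bigr => f Ef.
have -> : #|ordered_bases S n|%:R ^+ n = \prod_(i < n) #|ordered_bases S n|%:R :> R.
  by rewrite prodr_const card_ord.
rewrite sum1dep_card -big_split /=.
(* The fibre of [base_sets] over [f] is a product of sets of orderings, one for each row. *)
rewrite (eq_card (B := family (fun i =>
  [set c in ordered_bases S n | c @: setT == f i]))).
  rewrite card_family foldrE big_map big_enum natr_prod /=; apply: eq_bigr => i _.
  rewrite card_orderings /uniform_pmf card_ordered_bases_eq; case: ifPn => fi;
    last by rewrite mul0r.
  rewrite natrM mulrCA mulVf ?mulr1 // pnatr_eq0 -lt0n; apply/card_gt0P.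
  by exists (f i).
move=> om; rewrite !in_set; apply/andP/familyP.
  move=> [/andP[/ffun_onP omO _] /eqP <-] i; rewrite in_set ffunE eqxx andbT.
  exact: omO.
move=> omf; have bE : base_sets om = f.
  by apply/ffunP => i; rewrite ffunE; have := omf i; rewrite inE => /andP[_ /eqP].
rewrite bE eqxx Ef andbT; split=> //; apply/ffun_onP => i.
by have := omf i; rewrite inE => /andP[].
Qed.

(** The [j]-th class takes entry [sg l j] of each row [l]. Classes are disjoint since [om l] and
    [sg l] are injective, and they cover since [sg l] is onto. *)
Lemma arrangeable_partition N om : om \in ffun_on (mem (ordered_bases S n)) ->
  arrangeable N om n -> transversal_partition (base_sets om).
Proof.
move=> /ffun_onP omO /existsP[sg /andP[_ /forallP dsg]].
pose elt j l : 'I_n * V := (l, om l (sg l j)).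
pose D j := [set elt j l | l in 'I_n].
have om_inj l : injective (om l) by apply: ordered_bases_inj; apply: omO.
have Dmeet j j' x : x \in D j -> x \in D j' -> j = j'.
  by move=> /imsetP[l _ ->] /imsetP[l' _ [<-]] /om_inj/perm_inj.
have Dinj : injective D.
  move=> j j' DD; have jD : elt j j \in D j by apply: imset_f.
  by apply: (Dmeet _ _ _ jD); rewrite -DD.
apply/existsP; exists [set D j | j in 'I_n]; apply/and3P; split.
- apply/and3P; split.
  + apply/eqP/setP => -[l v]; rewrite inE /= ffunE; apply/bigcupP/imsetP.
      move=> [_ /imsetP[j _ ->] /imsetP[l' _ [-> ->]]].
      by exists (sg l' j).
    move=> [j _ ->]; exists (D ((sg l)^-1%g j)); first exact: imset_f.
    by apply/imsetP; exists l => //; rewrite /elt permKV.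
  + apply/trivIsetP => _ _ /imsetP[j _ ->] /imsetP[j' _ ->] DD.
    apply/pred0P => x /=; apply/negP => /andP[xj xj'].
    by rewrite (Dmeet _ _ _ xj xj') eqxx in DD.
  + apply/negP => /imsetP[j _ D0]; have : elt j j \in D j by apply: imset_f.
    by rewrite -D0 inE.
- by rewrite card_imset // card_ord.
apply/forall_inP => _ /imsetP[j _ ->]; apply/andP; split.
  have bj := dsg j; rewrite prefix_span_basis in bj; apply: etrans bj; apply: perm_basis.
  rewrite (_ : [seq vecF (arranged om sg j l) | l <- _] =
    [seq vecF x.2 | x <- [seq elt j l | l <- enum 'I_n]]); last first.
    by rewrite -map_comp; apply: eq_map => l; rewrite /= ffunE.
  apply: perm_map; apply: uniq_perm.
  + exact: enum_uniq.
  + by rewrite map_inj_uniq ?enum_uniq // => l l' [].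
  move=> x; rewrite mem_enum; apply/imsetP/mapP => -[l _ ->]; exists l => //.
  by rewrite mem_enum.
apply/andP; split.
  by apply/subsetP => _ /imsetP[l _ ->]; rewrite inE /= ffunE imset_f.
apply/forallP => i; apply/cards1P; exists (elt j i); apply/setP => x.
rewrite in_set1 in_set; apply/andP/eqP => [[/imsetP[l _ ->] /= /eqP -> //]|->].
by split=> //; apply: imset_f.
Qed.

End OrderedBases.

(** * Choice of the parameters and conclusion *)

From mathcomp Require Import all_classical all_reals all_analysis.

Import numFieldNormedType.Exports.

Local Open Scope classical_set_scope.
Local Open Scope ring_scope.

Section FailureBound.
Variables (R : realFieldType) (n L s q : nat).
Hypotheses (L_gt0 : (0 < L)%N) (n_gt0 : (0 < n)%N) (n_le : (n <= 2 ^ L)%N).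
Hypotheses (q_le : (q <= 2 ^ s)%N) (L_small : (1000 * (s + 1) * (L * L * L) <= n)%N).
(** Used with [m = 3 * m'], since three factors of [3/4] are below [1/2]. In [n * m'], the part
    [15 * s * n * (L * L)] cancels the choices of tails, and [4 * n] pays for [2 ^ n], for [4 ^ n]
    and, with the last [n], for lower order terms. *)
Let m' := (15 * s * (L * L) + 4)%N.
Let w := (5 * L)%N.
Let N := (n - 3 * L)%N.
Let M := (w + 3 * m')%N.

(** The first inequality is what remains to be checked in [spread_term]; the second gives
    [n ^ (2 * M + 3) <= 2 ^ (n - M)] in [row_term]. *)
Lemma parameters_ineq :
  (2 * L + 5 * (L * L) + 18 * (L * m') <= n)%N /\ (L * (2 * M + 3) + M <= n)%N.
Proof.
have L2 : (L <= L * L)%N by rewrite leq_pmulr.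
have L3 : (L * L <= L * L * L)%N by rewrite leq_pmulr.
have sL3 : (s * (L * L) <= s * (L * L * L))%N by rewrite leq_mul2l L3 orbT.
rewrite /M /m' /w; move: L_gt0 L_small L2 L3 sL3; clear; split; nia.
Qed.

Let delta : R := 2 ^+ w * (3 / 4) ^+ N.

Lemma delta_ge0 : 0 <= delta.
Proof. by rewrite mulr_ge0 ?exprn_ge0 // divr_ge0. Qed.

(* [(3/4)^3 <= 1/2]. *)
Lemma delta_cube : delta ^+ 3 <= 2 ^+ (3 * w) * 2 ^- N.
Proof.
rewrite exprMn -exprM mulnC ler_wpM2l ?exprn_ge0 // exprAC -exprVn.
by apply: lerXn2r; rewrite ?nnegrE ?exprn_ge0 ?divr_ge0 ?invr_ge0 //; lra.
Qed.

Lemma threeL_le : (18 * L <= n)%N.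
Proof. by have [] := parameters_ineq; rewrite /m'; nia. Qed.

Lemma delta_le1 : delta <= 1.
Proof.
rewrite -(@expr_le1 _ 3) ?delta_ge0 //; apply: le_trans delta_cube _.
rewrite ler_pdivrMr ?exprn_gt0 // mul1r ler_weXn2l ?ler1n //.
by have := threeL_le; rewrite /w /N; lia.
Qed.

Lemma n5_le : (n ^ 5 <= 2 ^ w)%N.
Proof. by rewrite /w mulnC expnM leq_exp2r. Qed.

Lemma spread_term :
  (n * (n * (q ^ n) ^ (n - N)) ^ w * 2 ^ n)%:R * delta ^+ (3 * m') * 4 ^+ n <= n%:R^-1
    :> R.
Proof.
have n0 : 0 < n%:R :> R by rewrite ltr0n.
have dm : delta ^+ (3 * m') <= 2 ^+ (3 * w * m') * 2 ^- (N * m').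
  have -> : 2 ^+ (3 * w * m') * 2 ^- (N * m') = (2 ^+ (3 * w) * 2 ^- N) ^+ m' :> R.
    by rewrite exprMn exprVn -!exprM.
  rewrite exprM lerXn2r ?nnegrE ?mulr_ge0 ?invr_ge0 ?exprn_ge0 ?delta_ge0 //.
  exact: delta_cube.
have nN : (n - N = 3 * L)%N by have := threeL_le; rewrite /N; lia.
have cnt : (n * (n * (q ^ n) ^ (n - N)) ^ w * 2 ^ n <= 2 ^ (L + (L + s * n * (3 * L)) *
  w + n))%N.
  have w0 : (0 < w)%N by rewrite muln_gt0.
  have L30 : (0 < 3 * L)%N by rewrite muln_gt0.
  rewrite 2!(expnD 2) leq_mul2r leq_mul ?orbT // (expnM 2 _ w) leq_exp2r //.
  rewrite (expnD 2) leq_mul // nN (expnM 2 _ (3 * L)) leq_exp2r //.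
  by rewrite (expnM 2) leq_exp2r.
rewrite -[leRHS]mul1r ler_pdivlMr //.
apply: le_trans (_ : (2 ^ (L + (L + s * n * (3 * L)) * w + n))%:R * (2 ^+ (3 * w * m')
  * 2 ^- (N * m')) * 4 ^+ n * (2 ^ L)%:R <= _).
  apply: ler_pM; rewrite ?mulr_ge0 ?exprn_ge0 ?delta_ge0 ?ler_nat //.
  rewrite ler_wpM2r ?exprn_ge0 //.
  by apply: ler_pM; rewrite ?exprn_ge0 ?delta_ge0 ?ler_nat.
have -> : 4 = 2 ^+ 2 :> R by rewrite -natrX.
rewrite !natrX -[(2 ^+ 2) ^+ n]exprM mulrA.
rewrite [_ * 2 ^- _ * _]mulrAC [_ * 2 ^- _ * _]mulrAC.
rewrite ler_pdivrMr ?exprn_gt0 // mul1r -!exprD ler_weXn2l ?ler1n //.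
have [i1 _] := parameters_ineq.
have nm : (N * m' + 3 * (L * m') = n * m')%N.
  rewrite /N mulnBl (mulnA 3) subnK // leq_mul2r; apply/orP; right.
  by have := threeL_le; lia.
have nm' : (n * m' = 15 * (s * n * (L * L)) + 4 * n)%N by rewrite /m'; lia.
by move: i1 nm nm'; rewrite /w; clear; nia.
Qed.

Lemma row_term (i : 'I_n) :
  (if (i < N)%N then 2 ^- (n - i) else
     n%:R ^- 4 + n%:R ^+ (2 * M) * 2 ^- (n - M)) <= 2 * n%:R ^- 3 :> R.
Proof.
have n0 : 0 < n%:R :> R by rewrite ltr0n.
have n3 : 0 <= n%:R ^- 3 :> R by rewrite invr_ge0 exprn_ge0.
have n3L : (n ^ 3 <= 2 ^ (L * 3))%N by rewrite expnM leq_exp2r.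
case: ifP => iN.
  apply: le_trans (_ : n%:R ^- 3 <= _); last by rewrite ler_peMl // ler1n.
  rewrite lef_pV2 ?posrE ?exprn_gt0 // -!natrX ler_nat (leq_trans n3L) // leq_pexp2l //.
  by move: iN; rewrite /N; lia.
rewrite mulr_natl mulr2n lerD //.
  by rewrite lef_pV2 ?posrE ?exprn_gt0 // ler_weXn2l // ler1n.
rewrite ler_pdivrMr ?exprn_gt0 // [leRHS]mulrC ler_pdivlMr ?exprn_gt0 // -exprD -natrX
  -(natrX _ 2) ler_nat.
apply: leq_trans (_ : (2 ^ L) ^ (2 * M + 3) <= _)%N; first by rewrite leq_exp2r // addn3.
rewrite -expnM leq_pexp2l //; have [_] := parameters_ineq; lia.
Qed.

Lemma failure_bound :
  (n * (n * (q ^ n) ^ (n - N)) ^ w * 2 ^ n)%:R * delta ^+ (3 * m') * 4 ^+ n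
      + \sum_(i < n) 4 * n%:R * (if (i < N)%N then 2 ^- (n - i) else
           n%:R ^- 4 + n%:R ^+ (2 * M) * 2 ^- (n - M)) <= 9 / n%:R :> R.
Proof.
have n0 : n%:R != 0 :> R by rewrite pnatr_eq0 -lt0n.
(* The spread term costs [1/n], and the [n] rows cost [8/n^2] each. *)
have -> : 9 / n%:R = n%:R^-1 + \sum_(i < n) 4 * n%:R * (2 * n%:R ^- 3) :> R.
  by rewrite sumr_const card_ord -mulr_natl; field.
rewrite lerD ?spread_term //; apply: ler_sum => i _.
by rewrite ler_wpM2l ?row_term // mulr_ge0.
Qed.

End FailureBound.

(** With [t = L %/ 4], the bound [L <= 4 * 2 ^ t] gives [L ^ 4 <= 256 * 2 ^ L]; one factor
    [L >= 256 * C] then absorbs the constants. *)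
Lemma cube_le_exp C : exists L0, forall L, (L0 <= L)%N -> (C * (L * L * L) <= 2 ^ L)%N.
Proof.
exists (256 * C)%N => L CL.
have [->|C0] := posnP C; first by rewrite mul0n.
have L4 : (L * L * L * L <= 256 * 2 ^ L)%N.
  pose t := (L %/ 4)%N;
    have Lt : (L <= 4 * t.+1)%N by have := ltn_ceil L (isT : 0 < 4)%N; rewrite /t; lia.
  have t2 : (t.+1 <= 2 ^ t)%N by apply: ltn_expl.
  have -> : (L * L * L * L = L ^ 4)%N by rewrite !expnS expn0; lia.
  apply: leq_trans (_ : (4 * 2 ^ t) ^ 4 <= _)%N.
    by rewrite leq_exp2r //; apply: leq_trans Lt _; rewrite leq_mul2l t2.
  by rewrite expnMn leq_mul2l /= -expnM leq_pexp2l // leq_trunc_div.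
have L0 : (0 < L)%N by apply: leq_trans CL; rewrite muln_gt0.
rewrite -(@leq_pmul2l (256 * C)) ?muln_gt0 //.
apply: leq_trans (_ : C * (L * L * L * L) <= _)%N.
  by rewrite mulnC -mulnA leq_mul2l leq_mul2l CL !orbT.
by rewrite [(256 * C)%N]mulnC -(mulnA C 256) leq_mul2l L4 orbT.
Qed.

Lemma cube_up_log_le C : exists n0, forall n, (n0 <= n)%N ->
  (C * (up_log 2 n * up_log 2 n * up_log 2 n) <= n)%N.
Proof.
(* The factor 2 compensates for [up_log] rounding up: only [2 ^ (up_log 2 n).-1 < n] is
   available. *)
have [L0 HL] := cube_le_exp (2 * C); exists (2 ^ L0 + 2)%N => n n0n.
have n2 : (1 < n)%N by apply: leq_trans n0n; rewrite addn2.
have /andP[up1 up2] := up_log_bounds (isT : 1 < 2)%N n2.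
have L0u : (L0 <= up_log 2 n)%N.
  by rewrite -(@leq_exp2l 2) //; apply: leq_trans up2; apply: leq_trans n0n;
    rewrite leq_addr.
have := HL _ L0u; have u0 : (0 < up_log 2 n)%N by rewrite up_log_gt0.
rewrite -[in X in (_ <= X)%N](prednK u0) expnS -mulnA leq_mul2l /= => /leq_trans; apply.
exact: ltnW.
Qed.

Lemma indep_prob_le1 (R : realType) (F : fieldType) (S : {fset F}) n
    (E : pred {ffun 'I_n -> {set 'rV[S]_n}}) : (2 <= #|{: S}|)%N ->
  indep_prob (fun _ : 'I_n => @uniform_pmf R _ (bases S n)) E <= 1.
Proof.
move=> S2; have OB0 : 0 < #|ordered_bases S n|%:R :> R.
  by have := lt_le_trans (exprn_gt0 n (cardV_gt0 R n S2)) (card_ordered_bases R n S2);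
    rewrite pmulr_rgt0.
rewrite -(ler_pM2r (exprn_gt0 n OB0)) mul1r indep_prob_uniform -natrX ler_nat.
apply: leq_trans (_ : #|ffun_on (mem (ordered_bases S n)) : {pred {ffun 'I_n -> _}}| <=
  _)%N; last first.
  by rewrite card_ffun_on card_ord.
apply: subset_leq_card.
by apply/fintype.subsetP => om; rewrite finset.in_set => /andP[].
Qed.

Lemma indep_prob_partition_ge (R : realType) (F : fieldType) (S : {fset F}) n :
  (2 <= #|{: S}|)%N -> (1 < n)%N ->
  (1000 * (up_log 2 #|{: S}| + 1) * (up_log 2 n * up_log 2 n * up_log 2 n) <= n)%N ->
  1 - 9 / n%:R <= indep_prob (fun _ : 'I_n => @uniform_pmf R _ (bases S n))
       (fun B : {ffun 'I_n -> {set 'rV[S]_n}} => transversal_partition B).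
Proof.
move=> S2 n1 small; set L := up_log 2 n in small *; set s := up_log 2 _ in small.
have OB0 : 0 < #|ordered_bases S n|%:R :> R.
  by have := lt_le_trans (exprn_gt0 n (cardV_gt0 R n S2)) (card_ordered_bases R n S2);
    rewrite pmulr_rgt0.
have n0 : (0 < n)%N by apply: ltnW.
have L0 : (0 < L)%N by rewrite up_log_gt0.
have nL : (n <= 2 ^ L)%N by apply: up_logP.
have qs : (#|{: S}| <= 2 ^ s)%N by apply: up_logP.
pose m := (3 * (15 * s * (L * L) + 4))%N; pose w := (5 * L)%N; pose N := (n - 3 * L)%N.
have Nn : (N <= n)%N by apply: leq_subr.
have wm0 : (0 < w + m)%N by rewrite addn_gt0 muln_gt0 L0.
have := not_arrangeable_count Nn S2 wm0 (n5_le nL) (delta_le1 R L0 n0 nL qs small).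
rewrite card_mx mul1n => bad.
have {}bad := le_trans bad (ler_wpM2r (exprn_ge0 n (ltW OB0)) (failure_bound R L0 n0 nL
  qs small)).
rewrite -(ler_pM2r (exprn_gt0 n OB0)) indep_prob_uniform mulrBl mul1r lerBlDr.
apply: le_trans (lerD (lexx _) bad); rewrite -natrX -natrD ler_nat.
apply: leq_trans (_ : #|ffun_on (mem (ordered_bases S n)) : {pred {ffun 'I_n -> _}}| <=
  _)%N.
  by rewrite card_ffun_on card_ord.
set G := [set om in _ | _]; set B := [set om in _ | _].
(* Every tuple of ordered bases is either good or not arrangeable, so the two sets cover the whole
   space. *)
apply: leq_trans (_ : #|G :|: B| <= _)%N; last by rewrite cardsU leq_subr.
apply: subset_leq_card; apply/fintype.subsetP => om omO.
apply/finset.setUP; have [ar|nar] := boolP (arrangeable N om n); [left|right].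
  by rewrite finset.in_set omO (arrangeable_partition omO ar).
by rewrite finset.in_set omO nar.
Qed.

Theorem theorem1p3 (R : realType) (F : fieldType) (S : {fset F})
    (S_ge2 : (2 <= #|` S|)%N) :
  (fun n : nat =>
     indep_prob (fun _ : 'I_n => @uniform_pmf R {set 'rV[S]_n} (bases S n))
       (fun B : {ffun 'I_n -> {set 'rV[S]_n}} => transversal_partition B))
    @ \oo --> (1 : R).
Proof.
have S2 : (2 <= #|{: S}|)%N by rewrite -cardfE.
have [n0 small] := cube_up_log_le (1000 * (up_log 2 #|{: S}| + 1)).
apply/cvgrPdist_le => e e0; near=> n.
have n1 : (1 < n)%N by near: n; apply: nbhs_infty_gt.
rewrite ger0_norm ?subr_ge0 ?indep_prob_le1 // lerBlDr -lerBlDl.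
apply: le_trans (indep_prob_partition_ge R S2 n1 (small n _)).
  rewrite lerB // ler_pdivrMr ?ltr0n 1?ltnW // mulrC -ler_pdivrMr //.
  by near: n; apply: nbhs_infty_ger.
by near: n; apply: nbhs_infty_ge.
Unshelve. all: by end_near.
Qed.
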